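(* Let $\mathbb{F}$ be a field with $\mathbb{F}\neq\mathbb{F}_2$. Every element of $EG_n(\mathbb{F})$ is the boundary behavior of some layerable circular planar $\mathbb{F}$-network (with boundary vertices labelled by $\{1,\dots,n\}$).
   Context: A graph is a finite undirected multigraph with vertex set $V$, oriented edges $E$ (endpoints $e_\pm$, reverse $\overline e$); degree of $p$ is $\#\{e:e_+=p\}$. A $\partial$-graph has $V=V^\circ\sqcup\partial V$. An $\mathbb{F}$-network has weights $w:E\to\mathbb{F}\setminus\{0\}$ with $w(e)=w(\overline e)$; $\Delta u(p)=\sum_{e_+=p}w(e)(u(e_+)-u(e_-))$; $u$ is harmonic if $\Delta u=0$ on $V^\circ$; its boundary behavior is $\Lambda=\{(u|_{\partial V},\Delta u|_{\partial V}):u\text{ harmonic}\}$. $EG_n(\mathbb{F})$ is the set of subspaces of $\mathbb{F}^n\times\mathbb{F}^n$ that are boundary behaviors of some finite $\mathbb{F}$-network with $\partial V=\{1,\dots,n\}$. Layerable: there is a finite sequence $G=G_0\supset G_1\supset\cdots\supset G_N=\varnothing$ where each step deletes a set of boundary edges (both endpoints boundary), deletes a set of isolated (degree-0) boundary vertices, or contracts a set of pairwise vertex-disjoint boundary spikes (an edge from a degree-1 boundary vertex $p$ to an interior vertex $q$; contraction removes $p$ and the edge and makes $q$ a boundary vertex). Circular planar: the $\partial$-graph admits a smooth embedding in the closed unit disk with $\partial V$ mapped exactly to the points where the image meets the boundary circle (edges smooth immersed arcs, the embedding injective). *)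

(* Defs.v *)
From HB Require Import structures.
From mathcomp Require Import all_boot all_order all_algebra.
From mathcomp Require Import all_classical all_reals all_analysis.

Set Implicit Arguments.
Unset Strict Implicit.
Unset Printing Implicit Defensive.

Import Order.TTheory GRing.Theory Num.Theory.
Import numFieldNormedType.Exports.
Local Open Scope ring_scope.

(* A finite undirected multigraph with boundary.  [edge] is the set of oriented
   edges, so each undirected edge (loops included) is a pair {e, erev e};
   [hd e] is e_+ and [tl e] is e_-. *)
Record bgraph := BGraph {
  vert : finType;
  edge : finType;
  erev : edge -> edge;
  hd : edge -> vert;
  bdry : {set vert};
  erevK : involutive erev;
  erev_neq : forall e, erev e != e }.

Arguments erev {_} _.
Arguments hd {_} _.
Arguments bdry _ : clear implicits.

Definition tl (G : bgraph) (e : edge G) : vert G := hd (erev e).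

Record network (F : fieldType) (n : nat) := Network {
  net_graph :> bgraph;
  weight : edge net_graph -> F;
  label : 'I_n -> vert net_graph;
  weight_neq0 : forall e, weight e != 0;
  weight_rev : forall e, weight (erev e) = weight e;
  label_inj : injective label;
  bdry_label : bdry net_graph = [set label i | i : 'I_n]%SET }.

Arguments weight {_ _} _ _.
Arguments label {_ _} _ _.

Section BoundaryBehavior.
Variables (F : fieldType) (n : nat).

Definition laplacian (N : network F n) (u : vert N -> F) (p : vert N) : F :=
  \sum_(e : edge N | hd e == p) weight N e * (u (hd e) - u (tl e)).

Definition net_harmonic (N : network F n) (u : vert N -> F) : Prop :=
  forall p, p \notin bdry N -> laplacian u p = 0.

Definition boundary_behavior (N : network F n)
    (L : {vspace ('rV[F]_n * 'rV[F]_n)%type}) : Prop :=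
  forall x : 'rV[F]_n * 'rV[F]_n, x \in L <->
    exists2 u : vert N -> F, net_harmonic u &
      x = (\row_i u (label N i), \row_i laplacian u (label N i)).

Definition EG (L : {vspace ('rV[F]_n * 'rV[F]_n)%type}) : Prop :=
  exists N : network F n, boundary_behavior N L.

End BoundaryBehavior.

Section Layering.
Variable G : bgraph.

(* The vertices, oriented edges and boundary vertices of a stage G_i of a
   layering of G; a vertex of G_i may be in its boundary without being in the
   boundary of G. *)
Record stage := Stage {
  stage_vert : {set vert G};
  stage_edge : {set edge G};
  stage_bdry : {set vert G} }.

Definition stage_degree (H : stage) (p : vert G) : nat :=
  #|[set e in stage_edge H | hd e == p]%SET|.

(* [e] is oriented from its interior end to its degree-1 boundary end. *)
Definition boundary_spike (H : stage) (e : edge G) : Prop :=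
  [/\ e \in stage_edge H,
      hd e \in stage_bdry H,
      stage_degree H (hd e) = 1%N &
      tl e \in stage_vert H :\: stage_bdry H].

Inductive layer_step (H : stage) : stage -> Prop :=
| DeleteBoundaryEdges (D : {set edge G}) :
    D \subset stage_edge H ->
    (forall e, e \in D -> erev e \in D) ->
    (forall e, e \in D -> hd e \in stage_bdry H /\ tl e \in stage_bdry H) ->
    layer_step H
      (Stage (stage_vert H) (stage_edge H :\: D) (stage_bdry H))
| DeleteIsolatedBoundaryVertices (S : {set vert G}) :
    S \subset stage_bdry H ->
    (forall p, p \in S -> stage_degree H p = 0%N) ->
    layer_step H
      (Stage (stage_vert H :\: S) (stage_edge H) (stage_bdry H :\: S))
| ContractBoundarySpikes (D : {set edge G}) :
    (forall e, e \in D -> boundary_spike H e) ->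
    (forall e e', e \in D -> e' \in D -> e != e' ->
       [disjoint [set hd e; tl e]%SET & [set hd e'; tl e']%SET]) ->
    layer_step H
      (Stage (stage_vert H :\: [set hd e | e in D]%SET)
             (stage_edge H :\: (D :|: [set erev e | e in D]%SET))
             ((stage_bdry H :\: [set hd e | e in D]%SET)
                :|: [set tl e | e in D]%SET)).

Definition layerable : Prop :=
  exists (N : nat) (H : nat -> stage),
    [/\ H 0%N = Stage [set: vert G]%SET [set: edge G]%SET (bdry G),
        H N = Stage finset.set0 finset.set0 finset.set0 &
        forall i, (i < N)%N -> layer_step (H i) (H i.+1)].

End Layering.

Section CircularPlanar.
Variable R : realType.

Definition smooth (f : R -> R) : Prop :=
  forall (k : nat) (t : R), derivable (derive1n k f) t 1.

Definition sqnorm (z : R * R) : R := z.1 ^+ 2 + z.2 ^+ 2.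

(* [pos] places the vertices and [arc e], restricted to [0, 1], parametrizes the
   edge e from e_- to e_+.  Smoothness of an arc on [0, 1] is expressed by
   asking it to be the restriction of a smooth map on R; nothing is required of
   that map outside [0, 1].  The last three conditions say that the induced map
   on the topological realization of G is injective; a loop is a smooth immersed
   arc whose two ends coincide. *)
Record disk_embedding (G : bgraph)
    (pos : vert G -> R * R) (arc : edge G -> R -> R * R) : Prop := {
  arc_smooth : forall e,
    smooth (fun t => (arc e t).1) /\ smooth (fun t => (arc e t).2);
  arc_immersed : forall e (t : R), 0 <= t <= 1 ->
    (derive1 (fun s => (arc e s).1) t, derive1 (fun s => (arc e s).2) t) <> (0, 0);
  arc_rev : forall e (t : R), 0 <= t <= 1 -> arc (erev e) t = arc e (1 - t);
  arc0 : forall e, arc e 0 = pos (tl e);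
  arc1 : forall e, arc e 1 = pos (hd e);
  pos_disk : forall p, sqnorm (pos p) <= 1;
  pos_circle : forall p, sqnorm (pos p) = 1 <-> p \in bdry G;
  arc_open_disk : forall e (t : R), 0 < t < 1 -> sqnorm (arc e t) < 1;
  pos_inj : injective pos;
  arc_avoids_vert : forall e (t : R) p, 0 < t < 1 -> arc e t <> pos p;
  arc_inj : forall e e' (t t' : R), 0 < t < 1 -> 0 < t' < 1 ->
    arc e t = arc e' t' ->
    (e' = e /\ t' = t) \/ (e' = erev e /\ t' = 1 - t) }.

Definition circular_planar (G : bgraph) : Prop :=
  exists (pos : vert G -> R * R) (arc : edge G -> R -> R * R),
    disk_embedding pos arc.

End CircularPlanar.

(* Main.v *)
From HB Require Import structures.
Require Import Defs.
From mathcomp Require Import all_boot all_order all_algebra ring lra zify.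
From mathcomp Require Import all_classical all_reals all_analysis.

(* Isolated boundary vertices, boundary edges and boundary spikes act on
   boundary behaviors by symplectic maps: a spike of resistance a at p replaces
   x_p by x_p + a y_p, an edge of weight w between p and q adds w (x_p - x_q) to
   y_p and w (x_q - x_p) to y_q.
   A boundary behavior L is Lagrangian and contains (1, 0). A suitable diagonal
   spike map makes it the graph of a symmetric matrix with zero row sums, that
   is, L comes from isolated vertices by adding a network of boundary edges and
   then spikes. To do this in a planar way it suffices to cross two consecutive
   wires using edges between these wires and spikes: five such operations cross
   the wires up to adding c (y_p + y_q) to both voltages, where c is any nonzero
   scalar, and three twisted crossings with c + c' + c'' = 0 give an exact one.
   The parameters 1, - t, t - 1 are available as soon as the field has an
   element t other than 0 and 1.
   The resulting network is a subgraph of a rectangular grid whose top row is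
   the boundary; it is drawn with straight segments and layered row by row. *)

Set Implicit Arguments.
Unset Strict Implicit.
Unset Printing Implicit Defensive.

Import Order.TTheory GRing.Theory Num.Theory.
Import numFieldNormedType.Exports.
Local Open Scope ring_scope.

(** * Edges and spikes as maps of states, and the maps realized by layers *)

Section Words.
Variables (F : fieldType) (n : nat).
Local Notation state := ('rV[F]_n * 'rV[F]_n)%type.
Implicit Types (x y d : 'rV[F]_n) (z : state) (C : 'M[F]_n) (p q : 'I_n) (w c : F).

Definition hadamard x y : 'rV[F]_n := \row_j (x 0 j * y 0 j).

Definition graph_laplacian C x : 'rV[F]_n :=
  \row_j \sum_i C i j * (x 0 j - x 0 i).

Definition spikes d z : state := (z.1 + hadamard d z.2, z.2).

Definition edges C z : state := (z.1, z.2 + graph_laplacian C z.1).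

Definition path_weights x : 'M[F]_n :=
  \matrix_(i, j) (if j == i.+1 :> nat then x 0 i
                  else if i == j.+1 :> nat then x 0 j else 0).

(* A layer (h, a) joins the consecutive wires i and i.+1 by an edge of weight
   h_i, or by no edge if h_i = 0, and then adds to each wire i a boundary spike
   of resistance a_i. *)
Definition layer := ('rV[F]_n * 'rV[F]_n)%type.

Definition layer_ok (l : layer) := [forall i, l.2 0 i != 0].

Definition add_layer z (l : layer) : state :=
  spikes l.2 (edges (path_weights l.1) z).

Definition layered (f : state -> state) : Prop :=
  exists2 s : seq layer, all layer_ok s & forall z, f z = foldl add_layer z s.

Lemma layered_id f : f =1 id -> layered f.
Proof. by move=> fE; exists [::] => // z; rewrite fE. Qed.

Lemma layered_comp f g : layered f -> layered g -> layered (fun z => g (f z)).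
Proof.
move=> [s s_ok fE] [s' s'_ok gE]; exists (s ++ s'); first by rewrite all_cat s_ok.
by move=> z; rewrite foldl_cat gE fE.
Qed.

Lemma eq_layered f g : f =1 g -> layered f -> layered g.
Proof. by move=> fg [s s_ok fE]; exists s => // z; rewrite -fg. Qed.

Lemma graph_laplacian0 x : graph_laplacian 0 x = 0.
Proof. by apply/rowP=> j; rewrite !mxE big1 // => i _; rewrite mxE mul0r. Qed.

Lemma graph_laplacianD C C' x :
  graph_laplacian (C + C') x = graph_laplacian C x + graph_laplacian C' x.
Proof.
apply/rowP=> j; rewrite !mxE -big_split; apply: eq_bigr => i _ /=.
by rewrite mxE mulrDl.
Qed.

Lemma edgesD C C' z : edges (C + C') z = edges C' (edges C z).
Proof. by rewrite /edges /= graph_laplacianD addrA. Qed.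

Lemma spikesD d d' z : spikes (d + d') z = spikes d' (spikes d z).
Proof.
congr (_, _); rewrite /= -addrA; congr (_ + _).
by apply/rowP=> j; rewrite !mxE mulrDl.
Qed.

Lemma edges0 z : edges 0 z = z.
Proof. by rewrite /edges graph_laplacian0 addr0 -surjective_pairing. Qed.

Lemma spikes0 z : spikes 0 z = z.
Proof.
rewrite /spikes (_ : hadamard _ _ = 0) ?addr0 -?surjective_pairing //.
by apply/rowP=> j; rewrite !mxE mul0r.
Qed.

Lemma path_weights0 : path_weights 0 = 0.
Proof. by apply/matrixP=> i j; rewrite !mxE; do 2?case: ifP. Qed.

Lemma spikesK d : cancel (spikes d) (spikes (- d)).
Proof. by move=> z; rewrite -spikesD subrr spikes0. Qed.

Definition edge_weights p q w : 'M[F]_n :=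
  \matrix_(i, j) (if (i == p) && (j == q) || (i == q) && (j == p) then w else 0).

Lemma graph_laplacian_edge p q w x : p != q ->
  graph_laplacian (edge_weights p q w) x =
  \row_j (if j == p then w * (x 0 p - x 0 q)
          else if j == q then w * (x 0 q - x 0 p) else 0).
Proof.
move=> pq; apply/rowP=> j; rewrite !mxE.
have [->|jp] := eqVneq j p.
  rewrite (bigD1 q) //= mxE !eqxx /= orbT big1 ?addr0 // => i iq.
  by rewrite mxE (negPf iq) (negPf pq) andbF mul0r.
have [->|jq] := eqVneq j q.
  rewrite (bigD1 p) //= mxE !eqxx big1 ?addr0 // => i ip.
  by rewrite mxE (negPf ip) [q == p]eq_sym (negPf pq) andbF mul0r.
by rewrite big1 // => i _; rewrite mxE (negPf jp) (negPf jq) !andbF mul0r.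
Qed.

Definition wires p q z : F * F * F * F := (z.1 0 p, z.2 0 p, z.1 0 q, z.2 0 q).

Definition set_wires p q z (v : F * F * F * F) : state :=
  (\row_j (if j == p then v.1.1.1 else if j == q then v.1.2 else z.1 0 j),
   \row_j (if j == p then v.1.1.2 else if j == q then v.2 else z.2 0 j)).

Definition on_wires p q (f : F * F * F * F -> F * F * F * F) z :=
  set_wires p q z (f (wires p q z)).

(** Reduces identities between words on two wires to identities between maps of four scalars, which
    [field] and [ring] decide. *)
Lemma on_wires_comp p q f g z : p != q ->
  on_wires p q g (on_wires p q f z) = on_wires p q (fun v => g (f v)) z.
Proof.
move=> pq; have qp : (q == p) = false by rewrite eq_sym (negPf pq).
have -> : on_wires p q g (on_wires p q f z) =
          set_wires p q (on_wires p q f z) (g (f (wires p q z))).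
  congr (set_wires _ _ _ (g _)).
  by rewrite /wires /= !mxE !eqxx qp; case: (f _) => [[[]]].
by congr (_, _); apply/rowP=> j; rewrite !mxE /=; case: (j == p); case: (j == q).
Qed.

Lemma eq_on_wires p q f g : f =1 g -> on_wires p q f =1 on_wires p q g.
Proof. by move=> fg z; rewrite /on_wires fg. Qed.

Definition spike2 (a b : F) (v : F * F * F * F) :=
  let: (x1, y1, x2, y2) := v in (x1 + a * y1, y1, x2 + b * y2, y2).

Definition edge2 (w : F) (v : F * F * F * F) :=
  let: (x1, y1, x2, y2) := v in
  (x1, y1 + w * (x1 - x2), x2, y2 + w * (x2 - x1)).

Definition swap2 (v : F * F * F * F) :=
  let: (x1, y1, x2, y2) := v in (x2, y2, x1, y1).

Lemma on_wires_edge2 p q w z : p != q ->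
  on_wires p q (edge2 w) z = edges (edge_weights p q w) z.
Proof.
move=> pq; rewrite /edges graph_laplacian_edge //.
congr (_, _); apply/rowP=> j; rewrite !mxE /=.
  by case: (eqVneq j p) => [->|] //; case: (eqVneq j q) => [->|].
by case: (eqVneq j p) => [->|] //; case: (eqVneq j q) => [->|] //; rewrite addr0.
Qed.

Lemma on_wires_spike2 p q a b z : p != q ->
  on_wires p q (spike2 a b) z =
  spikes (\row_j (if j == p then a else if j == q then b else 0)) z.
Proof.
move=> pq; congr (_, _); apply/rowP=> j; rewrite !mxE /=.
  by case: (eqVneq j p) => [->|] //; case: (eqVneq j q) => [->|] //; rewrite mul0r addr0.
by case: (eqVneq j p) => [->|] //; case: (eqVneq j q) => [->|].
Qed.

(** Conjugating by a crossing carries one end of an edge to the neighboring wire; this drives the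
    induction in [layered_edge]. *)
Lemma edge_by_swap r p q w z : r != p -> r != q -> p != q ->
  on_wires p q swap2 (edges (edge_weights r p w) (on_wires p q swap2 z)) =
  edges (edge_weights r q w) z.
Proof.
move=> rp rq pq; rewrite /edges !graph_laplacian_edge //.
have qp : (q == p) = false by rewrite eq_sym (negPf pq).
have pr : (p == r) = false by rewrite eq_sym (negPf rp).
have qr : (q == r) = false by rewrite eq_sym (negPf rq).
congr (_, _); apply/rowP=> j; rewrite !mxE /=.
  case: (eqVneq j p) => [->|jp]; first by rewrite mxE qp eqxx.
  by case: (eqVneq j q) => [->|//]; rewrite mxE eqxx.
rewrite !eqxx !(negPf pq, negPf rp, negPf rq).
case: (eqVneq j p) => [->|jp].
  by rewrite !mxE eqxx qp qr (negPf pq) pr.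
case: (eqVneq j q) => [->|jq]; last by case: (eqVneq j r) => [->|].
by rewrite !mxE eqxx pr qr.
Qed.

(** After the spike c on the first wire, the weight -1/c cancels y1 from the first current, leaving
    (x2 - x1)/c. The second edge then produces y2 there, hence y1 on the other wire, because edges
    preserve the sum of the two currents. *)
Lemma twisted_swap2 c v : c != 0 ->
  spike2 c 0 (edge2 (- c^-1) (spike2 c c (edge2 (- c^-1) (spike2 c 0 v)))) =
  (let: (x1, y1, x2, y2) := v in
   (x2 + c * (y1 + y2), y2, x1 + c * (y1 + y2), y1)).
Proof.
by case: v => [[[x1 y1] x2] y2] c0; congr (_, _, _, _); field.
Qed.

Hypothesis F_big : exists2 t : F, t != 0 & t != 1.

(** A third element t splits a nonzero c as c t + c (1 - t), while 0 = 1 + (- 1). Over F_2 the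
    element 1 has no such splitting. *)
Lemma sum_of_nonzero (c : F) : exists2 a : F, a != 0 & c - a != 0.
Proof.
have [->|c0] := eqVneq c 0.
  by exists 1; rewrite ?oner_eq0 // sub0r oppr_eq0 oner_eq0.
have [t t0 t1] := F_big; exists (c * t); first by rewrite mulf_neq0.
by rewrite -{1}[c]mulr1 -mulrBr mulf_neq0 // subr_eq0 eq_sym.
Qed.

(** A layer puts a nonzero spike on every wire, so each coordinate of d, possibly 0, is split into
    two nonzero resistances, one for each of two edgeless layers. *)
Lemma layered_spikes d : layered (spikes d).
Proof.
have /fin_all_exists[a aP] (i : 'I_n) : exists a, (a != 0) && (d 0 i - a != 0).
  by have [a a0 b0] := sum_of_nonzero (d 0 i); exists a; rewrite a0.
exists [:: (0, \row_i a i); (0, d - \row_i a i)].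
  by rewrite /= andbT; apply/andP; split; apply/forallP=> i;
     rewrite !mxE; case/andP: (aP i).
by move=> z; rewrite /= /add_layer /= path_weights0 !edges0 -spikesD subrKC.
Qed.

(** The unit spikes that accompany the edges in a layer are undone by spikes of resistance -1. *)
Lemma layered_path_edges h : layered (edges (path_weights h)).
Proof.
have L1 : layered (fun z => add_layer z (h, const_mx 1)).
  by exists [:: (h, const_mx 1)] => //=; rewrite andbT; apply/forallP=> i;
     rewrite mxE oner_eq0.
apply: eq_layered (layered_comp L1 (layered_spikes (- const_mx 1))) => z.
exact: spikesK.
Qed.

Lemma path_weights_delta p q w : q = p.+1 :> nat ->
  path_weights (\row_i (if i == p then w else 0)) = edge_weights p q w.
Proof.
move=> qp; apply/matrixP=> i j; rewrite !mxE.
rewrite -!val_eqE /= qp.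
by do ?[case: eqP => //= ?]; lia.
Qed.

Lemma layered_adjacent_edge p q w : q = p.+1 :> nat ->
  layered (edges (edge_weights p q w)).
Proof. by move=> qp; rewrite -(path_weights_delta w qp); apply: layered_path_edges. Qed.

Lemma adjacent_neq (p q : 'I_n) : q = p.+1 :> nat -> p != q.
Proof. by move=> qp; rewrite -val_eqE /= qp neq_ltn ltnSn. Qed.

Lemma layered_twisted_swap p q c : q = p.+1 :> nat -> c != 0 ->
  layered (on_wires p q (fun v => let: (x1, y1, x2, y2) := v in
    (x2 + c * (y1 + y2), y2, x1 + c * (y1 + y2), y1))).
Proof.
move=> qp c0; have pq := adjacent_neq qp.
have S a b : layered (on_wires p q (spike2 a b)).
  apply: eq_layered (layered_spikes _) => z.
  by rewrite on_wires_spike2.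
have E : layered (on_wires p q (edge2 (- c^-1))).
  apply: eq_layered (layered_adjacent_edge (- c^-1) qp) => z.
  by rewrite on_wires_edge2.
apply: eq_layered (layered_comp (layered_comp (layered_comp (layered_comp
  (S c 0) E) (S c c)) E) (S c 0)) => z.
rewrite !on_wires_comp //; apply: eq_on_wires => v /=; exact: twisted_swap2.
Qed.

(* Three twists cancel when their parameters are nonzero and add up to 0, as do
   1, - t and t - 1; such a triple is what F_2 lacks. *)
Lemma layered_swap p q : q = p.+1 :> nat -> layered (on_wires p q swap2).
Proof.
move=> qp; have pq := adjacent_neq qp; have [t t0 t1] := F_big.
have nt0 : - t != 0 by rewrite oppr_eq0.
have t10 : t - 1 != 0 by rewrite subr_eq0.
apply: eq_layered (layered_comp (layered_comp
  (layered_twisted_swap qp (oner_neq0 F)) (layered_twisted_swap qp nt0))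
  (layered_twisted_swap qp t10)) => z.
rewrite !on_wires_comp //; apply: eq_on_wires => -[[[x1 y1] x2] y2].
by congr (_, _, _, _); ring.
Qed.

Lemma layered_edge p q w : (p < q)%N -> layered (edges (edge_weights p q w)).
Proof.
elim/ltn_ind: {q}(q : nat) {-2}q (erefl (q : nat)) => m IH q qm pq.
have [qp|qp] := eqVneq (q : nat) p.+1; first exact: layered_adjacent_edge.
have r_lt : (q.-1 < n)%N by rewrite (leq_ltn_trans (leq_pred q)).
pose r := Ordinal r_lt; have qr : q = r.+1 :> nat by rewrite /=; lia.
have pr : (p < r)%N by rewrite /=; lia.
have rm : (r < m)%N by rewrite /=; lia.
have S := layered_swap qr.
(* Cross wires q - 1 and q, use the shorter edge from p to q - 1, and cross back. *)
apply: eq_layered (layered_comp (layered_comp S (IH _ rm r erefl pr)) S) => z.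
by apply: edge_by_swap; rewrite ?(adjacent_neq qr) // -val_eqE neq_ltn ?pr ?pq.
Qed.

Lemma layered_edges C : C^T = C -> layered (edges C).
Proof.
move=> C_sym.
have layered_sum (I : Type) (r : seq I) (P : pred I) (f : I -> 'M[F]_n) :
    (forall i, P i -> layered (edges (f i))) ->
    layered (edges (\sum_(i <- r | P i) f i)).
  move=> fP; apply: (big_ind (fun C => layered (edges C))) => //.
    by apply: layered_id => z; rewrite edges0.
  move=> C1 C2 L1 L2; apply: eq_layered (layered_comp L1 L2) => z.
  by rewrite edgesD.
(* This is an equality of maps, not of matrices: the right-hand sum has zero diagonal, and the
   diagonal of C is multiplied by x_j - x_j. *)
have -> : edges C =
    edges (\sum_(p < n) \sum_(q < n | (p < q)%N) edge_weights p q (C p q)).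
  apply/funext => z; congr (_, _ + _); apply/rowP=> j; rewrite !mxE.
  apply: eq_bigr => i _; have [->|ij] := eqVneq i j; first by rewrite subrr !mulr0.
  congr (_ * _); rewrite summxE; under eq_bigr do rewrite summxE.
  rewrite pair_big_dep /=.
  have [lt_ij|ge_ij] := ltnP i j.
    rewrite (bigD1 (i, j)) //= mxE !eqxx big1 ?addr0 // => -[p q] /= /andP[pq ne].
    rewrite mxE; case: ifP => // /orP[] /andP[/eqP Ei /eqP Ej].
      by rewrite Ei Ej eqxx in ne.
    by move: pq; rewrite -Ei -Ej ltnNge ltnW.
  have lt_ji : (j < i)%N by rewrite ltn_neqAle ge_ij eq_sym andbT.
  rewrite (bigD1 (j, i)) //= mxE !eqxx orbT -[in C j i]C_sym mxE.
  rewrite big1 ?addr0 // => -[p q] /= /andP[pq ne].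
  rewrite mxE; case: ifP => // /orP[] /andP[/eqP Ei /eqP Ej].
    by move: pq; rewrite -Ei -Ej ltnNge ltnW.
  by rewrite Ei Ej eqxx in ne.
by apply: (layered_sum) => p _; apply: (layered_sum) => q pq; apply: layered_edge.
Qed.

End Words.

(** * Normal form of Lagrangian subspaces that contain (1, 0) *)

Section Symplectic.
Variables (F : fieldType) (n : nat).
Local Notation state := ('rV[F]_n * 'rV[F]_n)%type.

Definition dot (x y : 'rV[F]_n) : F := \sum_i x 0 i * y 0 i.

Definition symplectic (z z' : state) : F := dot z.1 z'.2 - dot z'.1 z.2.

(** The row space of A is the annihilator of its kernel; the columns of [cokermx A] serve as test
    vectors. *)
Lemma solvable_mx m k (A : 'M[F]_(m, k)) (b : 'rV[F]_k) :
  (forall c : 'rV[F]_k, A *m c^T = 0 -> b *m c^T = 0) ->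
  exists v : 'rV[F]_m, b = v *m A.
Proof.
move=> H; suff /submxP[v ->] : (b <= A)%MS by exists v.
rewrite submxE; apply/eqP/matrixP=> i j; rewrite ord1 [RHS]mxE.
have Aj : A *m col j (cokermx A) = 0.
  by rewrite colE (mulmxA A) mulmx_coker mul0mx.
have := H (col j (cokermx A))^T; rewrite trmxK => /(_ Aj)/matrixP/(_ 0 0).
move: (cokermx A) => K; rewrite !mxE => E; rewrite -[RHS]E.
by apply: eq_bigr => l _; rewrite mxE.
Qed.

Lemma dotC x y : dot x y = dot y x.
Proof. by apply: eq_bigr => i _; rewrite mulrC. Qed.

Lemma dotP a x x' y : dot (a *: x + x') y = a * dot x y + dot x' y.
Proof.
rewrite /dot mulr_sumr -big_split; apply: eq_bigr => i _ /=.
by rewrite !mxE mulrDl mulrA.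
Qed.

Lemma dot0l y : dot 0 y = 0.
Proof. by rewrite /dot big1 // => i _; rewrite mxE mul0r. Qed.

Lemma dot_delta j y : dot (delta_mx 0 j) y = y 0 j.
Proof.
rewrite /dot (bigD1 j) //= mxE !eqxx mul1r big1 ?addr0 // => i ij.
by rewrite mxE (negPf ij) andbF mul0r.
Qed.

Lemma symplecticP a z z' w :
  symplectic (a *: z + z') w = a * symplectic z w + symplectic z' w.
Proof. by rewrite /symplectic /= ![dot w.1 _]dotC !dotP; ring. Qed.

Lemma symplectic_sum m (a : 'I_m -> F) (z : 'I_m -> state) w :
  symplectic (\sum_i a i *: z i) w = \sum_i a i * symplectic (z i) w.
Proof.
elim/big_rec2: _ => [|i s t _ <-]; last exact: symplecticP.
by rewrite /symplectic /= dot0l dotC dot0l subrr.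
Qed.

(** The vectors (- d c, c), with coordinatewise product, are those whose voltage vanishes after
    [spikes d]. They measure the failure of the image of L to be a graph over the voltages. *)
Lemma symplectic_spike_kernel d c z :
  symplectic z (- hadamard d c, c) = dot (spikes d z).1 c.
Proof.
rewrite /symplectic /dot -sumrB; apply: eq_bigr => i _.
by rewrite !mxE; ring.
Qed.

Lemma symplectic_spikes d z z' :
  symplectic (spikes d z) (spikes d z') = symplectic z z'.
Proof.
rewrite /symplectic /dot -!sumrB; apply: eq_bigr => i _.
by rewrite !mxE; ring.
Qed.

Variable L : {vspace state}.
Hypothesis L_isotropic : forall z z', z \in L -> z' \in L -> symplectic z z' = 0.
Hypothesis L_maximal :
  forall z, (forall z', z' \in L -> symplectic z' z = 0) -> z \in L.
Hypothesis L_const : (const_mx 1, 0) \in L.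

(* Coordinate by coordinate, a unit spike is added exactly when it is needed to
   keep the kernel of the voltages trivial. *)
Lemma exists_transverse_spikes :
  exists d, forall c, (- hadamard d c, c) \in L -> c = 0.
Proof.
(* Induction on k, with triviality required only of kernel vectors supported on the first k
   coordinates. *)
suff /(_ n)[d dP] : forall k, exists d, forall c, (- hadamard d c, c) \in L ->
    (forall i : 'I_n, (k <= i)%N -> c 0 i = 0) -> c = 0.
  by exists d => c cL; apply: dP cL _ => i; rewrite leqNgt ltn_ord.
elim=> [|k [d IH]].
  by exists 0 => c _ c0; apply/rowP=> i; rewrite c0 // mxE.
have [dk|] := pselect (forall c, (- hadamard d c, c) \in L ->
    (forall i : 'I_n, (k < i)%N -> c 0 i = 0) -> c = 0).
  by exists d.
move=> /existsNP[c] /not_implyP[cL] /not_implyP[c0 c_neq0].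
have [lt_kn|ge_kn] := ltnP k n; last first.
  case: c_neq0; apply: IH cL _ => i ki.
  by have := leq_trans ge_kn ki; rewrite leqNgt ltn_ord.
pose o := Ordinal lt_kn.
have below (c' : 'rV[F]_n) : (forall i : 'I_n, (k < i)%N -> c' 0 i = 0) -> c' 0 o = 0 ->
    forall i : 'I_n, (k <= i)%N -> c' 0 i = 0.
  move=> c'0 c'o i; rewrite leq_eqVlt => /orP[/eqP ki|]; last exact: c'0.
  by rewrite (_ : i = o) //; apply: val_inj.
exists (d + delta_mx 0 o) => c' c'L c'0; suff c'o : c' 0 o = 0.
  apply: IH _ (below _ c'0 c'o).
  rewrite (_ : hadamard d c' = hadamard (d + delta_mx 0 o) c') //.
  apply/rowP=> i; rewrite !mxE; have [->|io] := eqVneq i o.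
    by rewrite c'o !mulr0.
  by rewrite andbF addr0.
have co : c 0 o != 0.
  by apply: contra_notN c_neq0 => /eqP co; apply: IH cL (below _ c0 co).
(* Here c is in the kernel for d and c' in the kernel for d + e_k, so [spikes d] leaves the voltage
   - c'_k e_k on the latter. Their pairing is - c'_k c_k, and c_k is nonzero. *)
have := L_isotropic c'L cL.
rewrite symplectic_spike_kernel /=.
rewrite (_ : _ + _ = (- c' 0 o) *: delta_mx 0 o + 0); last first.
  apply/rowP=> i; rewrite !mxE; have [->|io] := eqVneq i o.
    by rewrite eqxx mulr1n; ring.
    by rewrite andbF mulr0n; ring.
rewrite dotP dot0l addr0 dot_delta => /eqP.
by rewrite mulf_eq0 (negPf co) orbF oppr_eq0 => /eqP.
Qed.

(** After transverse spikes the projection of L to voltages is bijective, so the image is a graph y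
    = x M. Isotropy makes M symmetric, and (1, 0) in L makes its column sums vanish; thus M acts as
    the graph Laplacian with weights - M, and undoing the spikes recovers L. *)
Lemma Lagrangian_normal_form :
  exists d (C : 'M[F]_n), C^T = C /\
    forall z, z \in L <-> exists x, z = spikes d (edges C (x, 0)).
Proof.
have [d dP] := exists_transverse_spikes.
(* If c annihilates all the voltages, then (- d c, c) is orthogonal to L, hence in L by maximality,
   hence c = 0 by transversality. *)
have onto x : exists2 z, z \in L & (spikes d z).1 = x.
  pose A := \matrix_(i < \dim L) (spikes d (vbasis L)`_i).1.
  have [|v xE] := @solvable_mx _ _ A x.
    move=> c Ac; rewrite (dP c) ?trmx0 ?mulmx0 //; apply: L_maximal => z zL.
    rewrite (coord_vbasis zL) symplectic_sum big1 // => i _.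
    rewrite symplectic_spike_kernel.
    have /rowP/(_ i) : (A *m c^T)^T = 0 by rewrite Ac trmx0.
    rewrite [RHS]mxE 2![LHS]mxE => E; rewrite [X in _ * X](_ : _ = 0) ?mulr0 //.
    by rewrite -[RHS]E; apply: eq_bigr => k _; rewrite [c^T _ _]mxE [A _ _]mxE.
  exists (\sum_i v 0 i *: (vbasis L)`_i).
    by apply: memv_suml => i _; rewrite memvZ // vbasis_mem // mem_nth // size_tuple.
  rewrite xE mulmx_sum_row; apply/esym.
  elim/big_rec2: _ => [|i s t _ ->].
    by apply/rowP=> i; rewrite !mxE mulr0 addr0.
  by rewrite rowK; apply/rowP=> k; rewrite !mxE /=; ring.
have /fin_all_exists2[w wL wE] := fun j : 'I_n => onto (delta_mx 0 j).
pose M : 'M[F]_n := \matrix_j (w j).2.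
pose lift (x : 'rV[F]_n) := \sum_j x 0 j *: w j.
have liftL x : lift x \in L by apply: memv_suml => j _; rewrite memvZ.
have liftE x : spikes d (lift x) = (x, x *m M).
  have -> : x *m M = (lift x).2.
    rewrite mulmx_sum_row /lift; elim/big_rec2: _ => [//|i s t _ ->].
    by rewrite rowK.
  congr (_, _); rewrite [RHS](row_sum_delta x) /lift.
  elim/big_rec2: _ => [|i s t _ <-].
    by apply/rowP=> i; rewrite !mxE mulr0 addr0.
  by rewrite -wE; apply/rowP=> k; rewrite !mxE /=; ring.
(* Subtracting the lift with the same voltage leaves a kernel vector y of L, which vanishes by
   transversality. *)
have LE z : z \in L -> spikes d z = ((spikes d z).1, (spikes d z).1 *m M).
  move=> zL; rewrite -liftE; congr (spikes d _); apply/eqP; rewrite -subr_eq0.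
  set y := z - _; have yL : y \in L by rewrite memvB.
  have y0 : (spikes d y).1 = 0.
    have : (spikes d (lift (spikes d z).1)).1 = (spikes d z).1 by rewrite liftE.
    rewrite /y; move: (lift _) => z' /rowP E; apply/rowP=> i.
    move: (E i); rewrite !mxE /= => /eqP; rewrite eq_sym -subr_eq0 => /eqP <-.
    by ring.
  have yE : y = (- hadamard d y.2, y.2).
    rewrite [LHS]surjective_pairing; congr (_, _).
    by apply/eqP; rewrite -addr_eq0; apply/eqP.
  rewrite yE (dP y.2) -?yE //; apply/eqP; congr (_, _).
  by apply/rowP=> i; rewrite !mxE mulr0 ?oppr0.
have M_sym : M^T = M.
  apply/matrixP=> i j; rewrite mxE.
  have := L_isotropic (wL i) (wL j).
  rewrite -(symplectic_spikes d) /symplectic !wE !dot_delta !mxE.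
  by move=> /eqP; rewrite subr_eq0 => /eqP.
have M_const j : \sum_i M i j = 0.
  have := LE _ L_const; rewrite /spikes /=.
  rewrite (_ : _ + _ = const_mx 1) => [[] E|]; last first.
    by apply/rowP=> i; rewrite !mxE mulr0 addr0.
  have /rowP/(_ j) := E; rewrite !mxE => E'; rewrite [RHS]E'.
  by apply: eq_bigr => i _; rewrite !mxE mul1r.
exists (- d), (- M); split=> [|z]; first by rewrite linearN /= M_sym.
have edgesE x : edges (- M) (x, 0) = (x, x *m M).
  congr (_, _); rewrite add0r; apply/rowP=> j; rewrite !mxE.
  rewrite (eq_bigr (fun i => x 0 i * M i j - x 0 j * M i j)) => [|i _].
    by rewrite sumrB -mulr_sumr M_const mulr0 subr0.
  by rewrite mxE; ring.
split=> [zL|[x ->]].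
  by exists (spikes d z).1; rewrite edgesE -LE // spikesK.
by rewrite edgesE -liftE spikesK.
Qed.

End Symplectic.

(** * Boundary behaviors are Lagrangian *)

Section Harmonic.
Variables (F : fieldType) (n : nat) (N : network F n).
Implicit Types u v : vert N -> F.

Lemma sum_mul_laplacian u v :
  \sum_p v p * laplacian u p =
  \sum_e weight N e * (v (hd e) * (u (hd e) - u (tl e))).
Proof.
under eq_bigr do rewrite /laplacian mulr_sumr.
rewrite (exchange_big_dep predT) //=; apply: eq_bigr => e _.
rewrite (big_pred1 (hd e)) => [|p]; first by ring.
by rewrite /= eq_sym.
Qed.

(** The terms in u(e_+) v(e_+) cancel, and the mixed terms are exchanged by reversing the edges. *)
Lemma green u v : \sum_p v p * laplacian u p = \sum_p u p * laplacian v p.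
Proof.
rewrite !sum_mul_laplacian; apply/eqP; rewrite -subr_eq0 -sumrB.
rewrite (eq_bigr (fun e => weight N e * (u (hd e) * v (tl e)) -
  weight N e * (v (hd e) * u (tl e)))) => [|e _]; last by ring.
rewrite sumrB subr_eq0 (reindex_inj (inv_inj (@erevK N))) /=; apply/eqP.
by apply: eq_bigr => e _; rewrite weight_rev /tl erevK; ring.
Qed.

Definition dirac q : vert N -> F := fun p => (p == q)%:R.

Lemma sum_dirac q (f : vert N -> F) : \sum_p dirac q p * f p = f q.
Proof.
rewrite (bigD1 q) //= /dirac eqxx mul1r big1 ?addr0 // => p /negPf->.
by rewrite mul0r.
Qed.

Lemma laplacian_dirac u p : laplacian u p = \sum_q u q * laplacian (dirac p) q.
Proof. by rewrite -green sum_dirac. Qed.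

Lemma laplacian_dirac_sym p q : laplacian (dirac p) q = laplacian (dirac q) p.
Proof. by rewrite laplacian_dirac sum_dirac. Qed.

Lemma sum_bdry (f : vert N -> F) :
  \sum_(p in bdry N) f p = \sum_i f (label N i).
Proof.
by rewrite bdry_label big_imset //= => i j _ _; apply: label_inj.
Qed.

Lemma label_bdry i : label N i \in bdry N.
Proof. by rewrite bdry_label imset_f. Qed.

Definition boundary_data u : 'rV[F]_n * 'rV[F]_n :=
  (\row_i u (label N i), \row_i laplacian u (label N i)).

(** Interior vertices contribute nothing, so the boundary pairing is a sum over all vertices, to
    which Green's identity applies. *)
Lemma dot_boundary_data u v : net_harmonic v ->
  dot (boundary_data u).1 (boundary_data v).2 = \sum_p u p * laplacian v p.
Proof.
move=> vH; rewrite (bigID (mem (bdry N))) /= [X in _ + X]big1 ?addr0.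
  by rewrite sum_bdry; apply: eq_bigr => i _; rewrite !mxE.
by move=> p pN; rewrite vH ?mulr0.
Qed.

Lemma harmonic_isotropic u v : net_harmonic u -> net_harmonic v ->
  symplectic (boundary_data u) (boundary_data v) = 0.
Proof. by move=> uH vH; rewrite /symplectic !dot_boundary_data // green subrr. Qed.

Lemma harmonic_const : net_harmonic (fun _ : vert N => 1) /\
  boundary_data (fun _ => 1) = (const_mx 1, 0).
Proof.
have lap0 p : laplacian (fun _ : vert N => 1) p = 0 :> F.
  by rewrite /laplacian big1 // => e _; rewrite subrr mulr0.
by split=> [p _|]; rewrite ?lap0 //; congr (_, _); apply/rowP=> i; rewrite !mxE ?lap0.
Qed.

(** Extension by zero to the interior, used for prescribed voltages and for prescribed currents
    alike. *)
Definition extend (x : 'rV[F]_n) : vert N -> F :=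
  fun p => \sum_i x 0 i * dirac (label N i) p.

Lemma extend_label x i : extend x (label N i) = x 0 i.
Proof.
rewrite /extend (bigD1 i) //= /dirac eqxx mulr1 big1 ?addr0 // => j ji.
by rewrite (inj_eq (@label_inj _ _ N)) eq_sym (negPf ji) mulr0.
Qed.

Lemma sum_extend x (f : vert N -> F) :
  \sum_p extend x p * f p = \sum_i x 0 i * f (label N i).
Proof.
under eq_bigr do rewrite /extend mulr_suml.
rewrite exchange_big /=; apply: eq_bigr => i _.
by under eq_bigr do rewrite -mulrA; rewrite -mulr_sumr sum_dirac.
Qed.

(* The Fredholm alternative for the symmetric Laplacian. *)
Lemma harmonic_maximal z :
  (forall u, net_harmonic u -> symplectic (boundary_data u) z = 0) ->
  exists2 u, net_harmonic u & z = boundary_data u.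
Proof.
case: z => x y /= xyP.
pose V := vert N; pose val := @enum_val V predT.
(* A solution t of t A = b is an interior correction to [extend x]: A is the Laplacian with its
   boundary rows set to 0, and b is the Laplacian that the correction must have. *)
pose A := \matrix_(i < #|V|, j < #|V|)
  ((val i \notin bdry N)%:R * laplacian (dirac (val j)) (val i)).
pose b := \row_(j < #|V|) (extend y (val j) - laplacian (extend x) (val j)).
have [|t bE] := @solvable_mx _ _ _ A b.
  move=> c Ac; apply/matrixP=> i0 j0; rewrite !ord1 !mxE {i0 j0}.
  (* A kernel vector of A is a harmonic function v, and its product with b is the symplectic pairing
     of its boundary data with (x, y). *)
  pose v p := c 0 (enum_rank p).
  have sumV (f g : V -> F) :
      \sum_(j < #|V|) f (val j) * g (val j) = \sum_p f p * g p.
    by rewrite [RHS](reindex _ (onW_bij _ (@enum_val_bij V))).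
  have cE j : c 0 j = v (val j) by rewrite /v enum_valK.
  have vH : net_harmonic v.
    move=> q qN; have /matrixP/(_ (enum_rank q) 0) := Ac.
    rewrite !mxE; under eq_bigr => j _ do rewrite !mxE cE /val enum_rankK qN mul1r mulrC.
    rewrite (sumV v (fun p => laplacian (dirac p) q)) => E.
    rewrite laplacian_dirac -[RHS]E; apply: eq_bigr => p _.
    by rewrite laplacian_dirac_sym.
  under eq_bigr => j _ do rewrite !mxE cE.
  rewrite (sumV (fun p => extend y p - laplacian (extend x) p)).
  under eq_bigr do rewrite mulrBl; rewrite sumrB sum_extend.
  under [X in _ - X]eq_bigr do rewrite mulrC.
  rewrite green sum_extend -[RHS](xyP v vH) /symplectic /dot /=.
  by congr (_ - _); apply: eq_bigr => i _; rewrite !mxE // mulrC.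
pose T p := t 0 (enum_rank p) * (p \notin bdry N)%:R.
pose u p := extend x p + T p.
have lapu p : laplacian u p = extend y p.
  have /rowP/(_ (enum_rank p)) := bE.
  rewrite !mxE /val enum_rankK => /eqP; rewrite subr_eq addrC => /eqP ->.
  rewrite laplacian_dirac; under eq_bigr do rewrite mulrDl.
  rewrite big_split /= -laplacian_dirac; congr (_ + _).
  rewrite [LHS](reindex _ (onW_bij _ (@enum_val_bij V))) /=.
  by apply: eq_bigr => i _; rewrite !mxE /T enum_valK /val enum_rankK mulrA.
exists u => [p pN|].
  rewrite lapu /extend big1 // => i _; rewrite /dirac.
  by case: eqP pN => [->|]; rewrite ?label_bdry ?mulr0.
congr (_, _); apply/rowP=> i; rewrite !mxE ?lapu ?extend_label //.
by rewrite /u /T label_bdry mulr0 addr0 extend_label.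
Qed.

End Harmonic.

Lemma EG_normal_form (F : fieldType) n (L : {vspace ('rV[F]_n * 'rV[F]_n)%type}) :
  EG L -> exists d (C : 'M[F]_n), C^T = C /\
    forall z, z \in L <-> exists x, z = spikes d (edges C (x, 0)).
Proof.
case=> N LN; apply: Lagrangian_normal_form.
- by move=> z z' /LN[u uH ->] /LN[v vH ->]; apply: harmonic_isotropic.
- move=> z zP; apply/LN; apply: harmonic_maximal => u uH.
  by apply: zP; apply/LN; exists u.
- have [H1 E] := harmonic_const N; apply/LN; exists (fun _ => 1) => //.
Qed.

(** * Networks given by a symmetric weight function, where weight 0 means no edge *)

Section SimpleNetwork.
Variables (F : fieldType) (n : nat) (V : finType) (wt : V -> V -> F).
Hypotheses (wt_sym : forall p q, wt p q = wt q p) (wt_irr : forall p, wt p p = 0).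
Variable lab : 'I_n -> V.
Hypothesis lab_inj : injective lab.

Definition simple_edge := {e : V * V | wt e.1 e.2 != 0}.

Fact simple_rev_subproof (e : simple_edge) : wt (val e).2 (val e).1 != 0.
Proof. by rewrite wt_sym (valP e). Qed.

Definition simple_rev (e : simple_edge) : simple_edge :=
  exist _ ((val e).2, (val e).1) (simple_rev_subproof e).

Fact simple_revK : involutive simple_rev.
Proof. by move=> e; apply: val_inj; rewrite /= -surjective_pairing. Qed.

Fact simple_rev_neq e : simple_rev e != e.
Proof.
apply/eqP => /(congr1 val) /(congr1 fst) /= E.
by have := valP e; rewrite -E wt_irr eqxx.
Qed.

Definition simple_graph : bgraph :=
  @BGraph V simple_edge simple_rev (fun e => (val e).2)
    [set lab i | i : 'I_n]%SET simple_revK simple_rev_neq.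

Definition simple_network : network F n :=
  @Network F n simple_graph (fun e => wt (val e).1 (val e).2) lab
    (fun e => valP e) (fun e => wt_sym _ _) lab_inj erefl.

Lemma simple_laplacian (u : vert simple_network -> F) p :
  laplacian u p = \sum_q wt p q * (u p - u q).
Proof.
transitivity (\sum_(e : V * V | (wt e.1 e.2 != 0) && (e.2 == p))
    wt e.1 e.2 * (u e.2 - u e.1)).
  exact/esym/(big_sub_cond (fun e : V * V => wt e.1 e.2 != 0)
    (fun e => e.2 == p) (fun e => wt e.1 e.2 * (u e.2 - u e.1))).
rewrite -(pair_big_dep predT (fun q r => (wt q r != 0) && (r == p))
  (fun q r => wt q r * (u r - u q))) /=; apply: eq_bigr => q _.
rewrite (eq_bigl (fun r => (r == p) && (wt q p != 0))) => [|r].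
  rewrite big_mkcondr big_pred1_eq wt_sym.
  by case: eqP => //= ->; rewrite mul0r.
by case: (eqVneq r p) => [->|]; rewrite ?andbF ?andbT.
Qed.


End SimpleNetwork.

(** * The grid network of a word of layers and its boundary behavior *)

Section Grid.
Variables (F : fieldType) (n : nat) (s : seq (layer F n)).
Local Notation T := (size s).

Definition horizontal k : 'M[F]_n := path_weights (nth (0, 0) s k).1.

(** The spike of layer k on wire i becomes the edge between rows k and k + 1, with conductance the
    inverse of its resistance. *)
Definition vertical (i : 'I_n) (k l : nat) : F :=
  if l == k.+1 then ((nth (0, 0) s k).2 0 i)^-1
  else if k == l.+1 then ((nth (0, 0) s l).2 0 i)^-1 else 0.

(* Vertex (i, k) lies on wire i. The top row k = T carries no horizontal edges,
   because nth then returns its default value. *)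
Definition grid_weight (p q : 'I_n * 'I_T.+1) : F :=
  if p.1 == q.1 then vertical p.1 p.2 q.2
  else if p.2 == q.2 then horizontal p.2 p.1 q.1 else 0.

Lemma path_weights_sym (h : 'rV[F]_n) i j : path_weights h i j = path_weights h j i.
Proof. by rewrite !mxE; do 2!case: eqP => //; lia. Qed.

Lemma vertical_sym i k l : vertical i k l = vertical i l k.
Proof. by rewrite /vertical; do 2!case: eqP => //; lia. Qed.

Lemma grid_weight_sym p q : grid_weight p q = grid_weight q p.
Proof.
rewrite /grid_weight [q.1 == _]eq_sym [q.2 == _]eq_sym; case: eqP => [->|_].
  exact: vertical_sym.
by case: eqP => // ->; apply: path_weights_sym.
Qed.

Lemma grid_weight_irr p : grid_weight p p = 0.
Proof. by rewrite /grid_weight eqxx /vertical; case: eqP => //; lia. Qed.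

Definition top_label (i : 'I_n) : 'I_n * 'I_T.+1 := (i, ord_max).

Lemma top_label_inj : injective top_label.
Proof. by move=> i j []. Qed.

Definition grid_network :=
  simple_network grid_weight_sym grid_weight_irr top_label_inj.

Definition row_of (u : 'I_n * 'I_T.+1 -> F) k : 'rV[F]_n := \row_i u (i, inord k).

(** The part of the Laplacian on row k due to the edges from row k - 1. For harmonic potentials it
    is the second component of the state after k layers, so it starts at 0. *)
Definition current (U : nat -> 'rV[F]_n) k : 'rV[F]_n :=
  if k is k'.+1 then \row_i (vertical i k' k * (U k 0 i - U k' 0 i)) else 0.

Lemma row_ofE u i (k : 'I_T.+1) : u (i, k) = row_of u k 0 i.
Proof. by rewrite mxE inord_val. Qed.

Lemma sum_ord_pick m (f : nat -> F) N :
  \sum_(l < N) (if l == m :> nat then f l else 0) = if (m < N)%N then f m else 0.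
Proof.
case: ltnP => [mN|Nm].
  rewrite (bigD1 (Ordinal mN)) //= eqxx big1 ?addr0 // => l.
  by rewrite -val_eqE /= => /negPf->.
by rewrite big1 // => l _; case: eqP => // lm; have := ltn_ord l; lia.
Qed.

(** The three terms come from the edges below, within and above row k; the edge above contributes
    minus the current entering row k + 1. *)
Lemma grid_laplacian (u : vert grid_network -> F) i (k : 'I_T.+1) :
  laplacian u (i, k) =
  current (row_of u) k 0 i
  + graph_laplacian (horizontal k) (row_of u k) 0 i
  - (if (k < T)%N then current (row_of u) k.+1 0 i else 0).
Proof.
rewrite simple_laplacian.
transitivity (\sum_j \sum_l grid_weight (i, k) (j, l) * (u (i, k) - u (j, l))).
  by rewrite pair_bigA; apply: eq_bigr => -[j l].
set U := row_of u.
rewrite (bigD1 i) //= addrAC; congr (_ + _); last first.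
  rewrite mxE [RHS](bigD1 i) //= subrr mulr0 add0r; apply: eq_bigr => j ji.
  rewrite (bigD1 k) //= big1 => [|l lk].
    by rewrite addr0 /grid_weight /= eq_sym (negPf ji) eqxx -!row_ofE path_weights_sym.
  by rewrite /grid_weight /= eq_sym (negPf ji) eq_sym (negPf lk) mul0r.
pose f l := (vertical i k l) * (U k 0 i - U l 0 i).
transitivity (\sum_(l < T.+1) ((if l == k.+1 :> nat then f l else 0) +
   if (k : nat) is k'.+1 then if l == k' :> nat then f l else 0 else 0)).
  apply: eq_bigr => l _; rewrite /grid_weight /= eqxx !row_ofE -/U -/(f l) /f.
  rewrite /vertical; case: eqP => [lk|lk].
    case: (nat_of_ord k) lk => [|k'] lk; rewrite ?addr0 //.
    by case: eqP => // *; rewrite ?addr0 //; lia.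
  case: (nat_of_ord k) lk => [|k'] lk; first by rewrite mul0r addr0.
  by rewrite eqSS eq_sym; case: eqP; rewrite ?mul0r ?addr0 ?add0r.
rewrite big_split /= sum_ord_pick ltnS addrC; congr (_ + _).
  rewrite /current; case: (nat_of_ord k) (ltn_ord k) @f => [|k'] kT f.
    by rewrite big1 // mxE.
  by rewrite sum_ord_pick ltnW // mxE /f vertical_sym.
case: ifP => _; last by rewrite oppr0.
by rewrite /f mxE -mulrN opprB.
Qed.

(** Harmonicity on row k is the rule by which the edges of layer k change the current, and Ohm's law
    on the vertical edges is the rule by which its spikes change the voltage. Harmonic functions are
    thus the orbits of the layers from states (x, 0) on row 0. *)
Lemma grid_behavior z : all (@layer_ok F n) s ->
  (exists2 u : vert grid_network -> F, net_harmonic u &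
      z = (\row_i u (label grid_network i), \row_i laplacian u (label grid_network i)))
  <-> exists x, z = foldl (@add_layer F n) (x, 0) s.
Proof.
move=> /(all_nthP (0, 0)) s_ok.
have a_neq0 k i : (k < T)%N -> (nth (0, 0) s k).2 0 i != 0.
  by move=> kT; apply: (forallP (s_ok k kT)).
have rowsP (u : vert grid_network -> F) : net_harmonic u <->
    forall k, (k < T)%N -> current (row_of u) k.+1 =
      current (row_of u) k + graph_laplacian (horizontal k) (row_of u k).
  split=> [uH k kT|uH [i k]].
    apply/rowP=> i; rewrite [RHS]mxE; apply/eqP; rewrite eq_sym -subr_eq0.
    have kT1 : (k < T.+1)%N by rewrite ltnW.
    have := grid_laplacian u i (Ordinal kT1).
    rewrite -[nat_of_ord (Ordinal kT1)]/k kT => <-.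
    apply/eqP/uH; apply/imsetP => -[j _ [_ /eqP]].
    by rewrite eqn_leq [(T <= _)%N]leqNgt kT andbF.
  rewrite grid_laplacian; case: ifP => [kT _|kT /negP[]].
    by rewrite uH // [X in _ - X]mxE subrr.
  apply/imsetP; exists i => //; congr (_, _); apply: val_inj => /=.
  by have := ltn_ord k; lia.
have stateP (u : vert grid_network -> F) : net_harmonic u <->
    forall k, (k <= T)%N -> (row_of u k, current (row_of u) k) =
      foldl (@add_layer F n) (row_of u 0, 0) (take k s).
  split=> [/rowsP uH|uH].
    elim=> [|k IH] kT; first by rewrite take0.
    rewrite (take_nth (0, 0)) // foldl_rcons -IH ?(ltnW kT) //.
    rewrite /add_layer /spikes /= -uH //; congr (_, _).
    apply/rowP=> i; rewrite [RHS]mxE [X in _ + X]mxE [X in _ * X]mxE /vertical eqxx.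
    by rewrite mulrA mulfV ?mul1r ?a_neq0 // addrC subrK.
  apply/rowsP => k kT; have := uH k.+1 kT.
  by rewrite (take_nth (0, 0)) // foldl_rcons -uH ?(ltnW kT) // => -[].
(* The top row has no edges above it and, by the default value of [nth], no horizontal ones, so its
   Laplacian is the incoming current. *)
have topE (u : vert grid_network -> F) :
    (\row_i u (label grid_network i), \row_i laplacian u (label grid_network i)) =
    (row_of u T, current (row_of u) T).
  have inT : inord T = ord_max :> 'I_T.+1 by apply: val_inj; rewrite /= inordK.
  congr (_, _); apply/rowP=> i; first by rewrite !mxE inT.
  rewrite mxE grid_laplacian /= ltnn subr0 /horizontal nth_default //=.
  by rewrite path_weights0 graph_laplacian0 [X in _ + X]mxE addr0.
split=> [[u /stateP uH ->]|[x ->]].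
  by exists (row_of u 0); rewrite topE uH // take_size.
(* Conversely, the voltages of the successive states define a potential on the grid. *)
pose st k := foldl (@add_layer F n) (x, 0) (take k s).
pose u (p : 'I_n * 'I_T.+1) := (st p.2).1 0 p.1.
have rowE k : (k <= T)%N -> row_of u k = (st k).1.
  by move=> kT; apply/rowP=> i; rewrite mxE /u /= inordK.
have uS k : (k <= T)%N -> (row_of u k, current (row_of u) k) = st k.
  case: k => [|k] kT; first by rewrite rowE // /st take0.
  rewrite [RHS]surjective_pairing rowE //; congr (_, _).
  apply/rowP=> i; rewrite [LHS]mxE !rowE ?(ltnW kT) // /vertical eqxx.
  rewrite /st (take_nth (0, 0)) // foldl_rcons -/(st k) /add_layer /spikes /=.
  by rewrite [X in _ * (X - _)]mxE addrAC subrr add0r [X in _ * X]mxE mulKf ?a_neq0.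
have u0 : row_of u 0 = x by rewrite rowE // /st take0.
exists u; last by rewrite topE uS // /st take_size.
by apply/stateP=> k kT; rewrite u0; apply: uS.
Qed.

End Grid.

(** * Layering the grid row by row *)

Section Layering.
Variable G : bgraph.

(** Layerability from an arbitrary stage, so that a sequence can be built by prepending steps. *)
Definition peelable (H : stage G) : Prop :=
  exists (k : nat) (S : nat -> stage G),
    [/\ S 0%N = H, S k = Stage finset.set0 finset.set0 finset.set0 &
        forall i, (i < k)%N -> layer_step (S i) (S i.+1)].

Lemma peelable_empty : peelable (Stage finset.set0 finset.set0 finset.set0).
Proof. by exists 0, (fun _ => Stage finset.set0 finset.set0 finset.set0). Qed.

Lemma peelable_step H H' : layer_step H H' -> peelable H' -> peelable H.
Proof.
move=> HH' [k [S [S0 Sk SP]]].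
exists k.+1, (fun i => if i is j.+1 then S j else H); split=> //.
by case=> [|i] ik; rewrite ?S0 //; apply: SP.
Qed.

End Layering.

Section GridLayering.
Variables (F : fieldType) (n : nat) (s : seq (layer F n)).
Hypothesis s_ok : all (@layer_ok F n) s.
Local Notation T := (size s).
Local Notation G := (grid_network s).

Lemma vertical_neq0 i k l : vertical s i k l != 0 ->
  (l = k.+1 /\ (k < T)%N) \/ (k = l.+1 /\ (l < T)%N).
Proof.
have nthT m : (T <= m)%N -> (nth (0, 0) s m).2 0 i = 0.
  by move=> Tm; rewrite nth_default // mxE.
rewrite /vertical; case: (l =P k.+1) => [lk|_].
  rewrite invr_eq0 => a0; left; split=> //.
  by rewrite ltnNge; apply: contraNN a0 => /nthT ->.
case: (k =P l.+1) => [kl|_]; last by rewrite eqxx.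
rewrite invr_eq0 => a0; right; split=> //.
by rewrite ltnNge; apply: contraNN a0 => /nthT ->.
Qed.

Lemma verticalS_neq0 i k : (k < T)%N -> vertical s i k k.+1 != 0.
Proof.
move=> kT; rewrite /vertical eqxx invr_eq0.
by move/(all_nthP (0, 0)): s_ok => /(_ k kT)/forallP.
Qed.

Lemma horizontal_neq0 k i j : horizontal s k i j != 0 ->
  (k < T)%N /\ (j = i.+1 :> nat \/ i = j.+1 :> nat).
Proof.
move=> h0; split.
  rewrite ltnNge; apply: contraNN h0 => Tk.
  by rewrite /horizontal nth_default // path_weights0 mxE.
move: h0; rewrite mxE; case: (nat_of_ord j =P _) => [|_]; first by left.
by case: (nat_of_ord i =P _) => [|_]; [right | rewrite eqxx].
Qed.

Lemma grid_edgeP (e : edge G) :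
  ((tl e).1 = (hd e).1 /\
     ((hd e).2 = (tl e).2.+1 :> nat \/ (tl e).2 = (hd e).2.+1 :> nat)) \/
  [/\ (tl e).2 = (hd e).2, ((tl e).2 < T)%N &
     (hd e).1 = (tl e).1.+1 :> nat \/ (tl e).1 = (hd e).1.+1 :> nat].
Proof.
case: e => -[[i k] [j l]] /= e0; rewrite /tl /=.
move: (e0); rewrite /grid_weight /=; case: (i =P j) => [<-|_].
  by move=> /vertical_neq0[] [lk _]; left; split=> //; [left | right].
case: (k =P l) => [<-|]; last by rewrite eqxx.
by move=> /horizontal_neq0[kT ij]; right.
Qed.

Lemma grid_edge_inj (e e' : edge G) : tl e = tl e' -> hd e = hd e' -> e = e'.
Proof.
case: e e' => [[p q] e0] [[p' q'] e0'] /= E1 E2.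
by apply: val_inj; congr (_, _).
Qed.

Definition rows_below m : {set vert G} := [set p : vert G | (p.2 < m)%N]%SET.

(** The index counts rows: the boundary is row m - 1. In [trimmed_stage m] below, the boundary is
    row m, already stripped of its horizontal edges. *)
Definition grid_stage m : stage G :=
  Stage (rows_below m)
    [set e | (hd e \in rows_below m) && (tl e \in rows_below m)]%SET
    [set p : vert G | p.2.+1 == m]%SET.

Definition trimmed_stage m : stage G :=
  Stage (rows_below m.+1)
    (stage_edge (grid_stage m.+1) :\:
       [set e : edge G | ((hd e).2 == m :> nat) && ((tl e).2 == m :> nat)])%SET
    [set p : vert G | p.2 == m :> nat]%SET.

Lemma trim_grid_stage m : layer_step (grid_stage m.+1) (trimmed_stage m).
Proof.
have := @DeleteBoundaryEdges _ (grid_stage m.+1)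
  [set e : edge G | ((hd e).2 == m :> nat) && ((tl e).2 == m :> nat)]%SET.
rewrite /trimmed_stage /= (_ : [set p : vert G | p.2.+1 == m.+1]%SET =
  [set p : vert G | p.2 == m :> nat]%SET).
  apply.
  - by apply/fintype.subsetP=> e; rewrite !inE => /andP[/eqP-> /eqP->]; rewrite ltnSn.
  - by move=> e; rewrite !inE /= andbC.
  - by move=> e; rewrite !inE => /andP[-> ->].
by apply/setP=> p; rewrite !inE eqSS.
Qed.

Lemma peel_last_row :
  layer_step (trimmed_stage 0) (Stage finset.set0 finset.set0 finset.set0).
Proof.
have E0 : stage_edge (trimmed_stage 0) = finset.set0.
  by apply/setP=> e; rewrite !inE !ltnS !leqn0 andNb.
have := @DeleteIsolatedBoundaryVertices _ (trimmed_stage 0)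
  (stage_bdry (trimmed_stage 0)).
rewrite E0 /= finset.setDv.
rewrite (_ : rows_below 1 :\: _ = finset.set0)%SET.
  apply=> // p _; rewrite /stage_degree E0.
  by apply/eqP; rewrite cards_eq0; apply/eqP/setP=> e; rewrite !inE.
by apply/setP=> p; rewrite !inE ltnS leqn0 andNb.
Qed.

(** Once row m + 1 is stripped, each of its vertices keeps only the vertical edge to row m, a spike.
    Spikes on different wires are disjoint, so all are contracted at once and row m becomes the
    boundary. *)
Lemma peel_row m : (m < T)%N -> layer_step (trimmed_stage m.+1) (grid_stage m.+1).
Proof.
move=> mT.
pose D := [set e : edge G | ((hd e).2 == m.+1 :> nat) && ((tl e).2 == m :> nat)]%SET.
have spikeE (e : edge G) : e \in D -> (tl e).1 = (hd e).1.
  rewrite inE => /andP[/eqP hE /eqP tE]; case: (grid_edgeP e) => [[]|[E]] //.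
  by move: hE; rewrite -E tE; lia.
have top_edge (e : edge G) : e \in stage_edge (trimmed_stage m.+1) ->
    (hd e).2 = m.+1 :> nat -> e \in D.
  rewrite !inE /= !ltnS => /andP[+ /andP[_ le_tl]] E; rewrite E eqxx /= => ne.
  case: (grid_edgeP e) => [[_]|[E' _ _]] /=; first lia.
  by have := congr1 val E'; move: E ne le_tl; rewrite /=; lia.
have spikes_ok e : e \in D -> boundary_spike (trimmed_stage m.+1) e.
  move=> eD; move: (eD); rewrite inE => /andP[/eqP hE /eqP tE].
  have eS : e \in stage_edge (trimmed_stage m.+1).
    by rewrite !inE hE tE !ltnS leqnn leqnSn eqxx /= andbT; lia.
  split=> //.
  - by rewrite !inE hE.
  - apply/eqP/cards1P; exists e; apply/setP=> e'; rewrite [LHS]inE [RHS]inE.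
    apply/andP/eqP => [[e'S /eqP hE']|->]; last by rewrite eS.
    have e'D : e' \in D by apply: top_edge; rewrite ?hE'.
    move: (e'D); rewrite inE => /andP[_ /eqP tE'].
    apply: grid_edge_inj => //.
    rewrite [LHS]surjective_pairing [RHS]surjective_pairing; congr (_, _).
      by rewrite (spikeE _ e'D) (spikeE _ eD) hE'.
    by apply: val_inj; rewrite /= in tE tE' *; rewrite tE tE'.
  - by rewrite !inE tE; lia.
have disj e e' : e \in D -> e' \in D -> e != e' ->
    [disjoint [set hd e; tl e]%SET & [set hd e'; tl e']%SET].
  move=> eD e'D ne; have ne1 : (hd e).1 != (hd e').1.
    move: (eD) (e'D); rewrite !inE => /andP[/eqP hE /eqP tE] /andP[/eqP hE' /eqP tE'].
    apply: contraNneq ne => E; apply/eqP/grid_edge_inj;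
      rewrite [LHS]surjective_pairing [RHS]surjective_pairing; congr (_, _) => //.
    - by rewrite (spikeE _ e'D) (spikeE _ eD).
    - by apply: val_inj; rewrite /= in tE tE' *; rewrite tE tE'.
    by apply: val_inj; rewrite /= in hE hE' *; rewrite hE hE'.
  rewrite disjoint_subset; apply/fintype.subsetP=> p; rewrite !inE => pE.
  have {}pE : p.1 = (hd e).1 by case/orP: pE => /eqP->; rewrite ?spikeE.
  by apply/norP; split; apply: contraNneq ne1 => pE'; rewrite -pE pE' ?spikeE.
have := @ContractBoundarySpikes _ (trimmed_stage m.+1) D spikes_ok disj.
set H := Stage _ _ _; rewrite (_ : H = grid_stage m.+1) // /H /grid_stage.
have mT1 : (m < T.+1)%N by rewrite ltnW.
(* Every wire has its spike because the resistances of a layer are nonzero; hence all of row m + 1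
   disappears and all of row m becomes boundary. *)
have spike_ex (i : 'I_n) : exists2 e : edge G, e \in D &
    hd e = (i, inord m.+1) /\ tl e = (i, Ordinal mT1).
  have e0 : grid_weight (i, Ordinal mT1) (i, inord m.+1 : 'I_T.+1) != 0 :> F.
    by rewrite /grid_weight /= eqxx inordK // verticalS_neq0.
  exists (exist _ ((i, Ordinal mT1), (i, inord m.+1 : 'I_T.+1)) e0) => //.
  by rewrite inE /= inordK // !eqxx.
have hdD : [set hd e | e in D]%SET = [set p : vert G | p.2 == m.+1 :> nat]%SET.
  apply/setP=> p; rewrite inE; apply/imsetP/eqP => [[e + ->]|pE].
    by rewrite inE => /andP[/eqP].
  have [e eD [hE _]] := spike_ex p.1; exists e => //.
  by rewrite hE [LHS]surjective_pairing; congr (_, _); apply: val_inj; rewrite /= inordK.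
have tlD : [set tl e | e in D]%SET = [set p : vert G | p.2 == m :> nat]%SET.
  apply/setP=> p; rewrite inE; apply/imsetP/eqP => [[e + ->]|pE].
    by rewrite inE => /andP[_ /eqP].
  have [e eD [_ tE]] := spike_ex p.1; exists e => //.
  by rewrite tE [LHS]surjective_pairing; congr (_, _); apply: val_inj.
congr Stage.
- by rewrite hdD; apply/setP=> p; rewrite !inE; lia.
- apply/setP=> e.
  have revD : (e \in [set erev e' | e' in D]%SET) = (erev e \in D).
    by rewrite -{1}[e]erevK mem_imset //; apply: (inv_inj (@erevK G)).
  rewrite finset.in_setD finset.in_setU revD !inE /tl erevK.
  case: (grid_edgeP e) => [[_]|[E' _ _]] /=; first lia.
  by have := congr1 val E'; rewrite /=; lia.
- by rewrite hdD tlD; apply/setP=> p; rewrite !inE; lia.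
Qed.

Lemma grid_layerable : layerable G.
Proof.
suff peel m : (m <= T)%N -> peelable (grid_stage m.+1).
  have [k [S [S0 Sk SP]]] := peel _ (leqnn T).
  exists k, S; split=> //; rewrite S0 /grid_stage; congr Stage.
  - by apply/setP=> p; rewrite !inE ltn_ord.
  - by apply/setP=> e; rewrite !inE !ltn_ord.
  apply/setP=> -[i k']; rewrite !inE eqSS; apply/eqP/imsetP => [kT|[j _ [_ ->]] //].
  by exists i => //; congr (_, _); apply: val_inj.
elim: m => [|m IH] mT; apply: (peelable_step (trim_grid_stage _)).
  exact: peelable_step peel_last_row (peelable_empty _).
exact: peelable_step (peel_row mT) (IH (ltnW mT)).
Qed.

End GridLayering.

(** * Straight segments between consecutive points of an increasing sequence *)

Section Segments.
Variable R : realType.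
Implicit Types (a b t : R) (f : nat -> R).

Definition lerp a b t : R := a + t * (b - a).

Lemma is_derive_lerp a b t : is_derive t 1 (lerp a b) (b - a).
Proof.
have -> : lerp a b = cst a \+ (id \* cst (b - a)) by [].
apply: is_derive_eq; rewrite /GRing.scale /=; ring.
Qed.

(** The constant derivative is written as a degenerate [lerp], so that this class is closed under
    differentiation and smoothness follows by induction. *)
Lemma derive1_lerp a b : derive1 (lerp a b) = lerp (b - a) (b - a).
Proof.
apply/funext => t; rewrite derive1E (@derive_val _ _ _ _ _ _ _ (is_derive_lerp a b t)).
by rewrite /lerp subrr mulr0 addr0.
Qed.

Lemma smooth_lerp a b : smooth (lerp a b).
Proof.
have derive1n_lerp k : exists a' b', derive1n k (lerp a b) = lerp a' b'.
  elim: k => [|k [a' [b' E]]]; first by exists a, b.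
  by exists (b' - a'), (b' - a'); rewrite derive1nS E derive1_lerp.
move=> k t; have [a' [b' ->]] := derive1n_lerp k.
by apply: ex_derive; apply: is_derive_lerp.
Qed.

Lemma lerp_rev a b t : lerp a b t = lerp b a (1 - t).
Proof. by rewrite /lerp; ring. Qed.

Lemma lerp_id a t : lerp a a t = a.
Proof. by rewrite /lerp; ring. Qed.

Lemma lerp_bounds a b t : a < b -> 0 < t < 1 -> a < lerp a b t < b.
Proof.
move=> ab /andP[t0 t1]; rewrite /lerp.
have p1 : 0 < t * (b - a) by rewrite mulr_gt0 // subr_gt0.
have p2 : 0 < (1 - t) * (b - a) by rewrite mulr_gt0 // subr_gt0.
by apply/andP; split; lra.
Qed.

Lemma onem_itv t : 0 < t < 1 -> 0 < 1 - t < 1.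
Proof. by move=> /andP[? ?]; apply/andP; split; lra. Qed.

Section Increasing.
Variables (f : nat -> R) (N : nat).
Hypothesis f_incr : forall k l, (k < l)%N -> (l <= N)%N -> f k < f l.

Let f_le k l : (k <= l)%N -> (l <= N)%N -> f k <= f l.
Proof. by rewrite leq_eqVlt => /orP[/eqP->//|kl lN]; rewrite ltW ?f_incr. Qed.

Let step_lt m m' t t' : (m < m')%N -> (m' < N)%N -> 0 < t < 1 -> 0 < t' < 1 ->
  lerp (f m) (f m.+1) t < lerp (f m') (f m'.+1) t'.
Proof.
move=> mm' m'N t01 t'01.
have /andP[_ lt1] := lerp_bounds (f_incr (ltnSn m) (leq_trans mm' (ltnW m'N))) t01.
have /andP[lt2 _] := lerp_bounds (f_incr (ltnSn m') m'N) t'01.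
exact: lt_trans (lt_le_trans lt1 (f_le mm' (ltnW m'N))) lt2.
Qed.

Let step_inj m m' t t' : (m < N)%N -> (m' < N)%N -> 0 < t < 1 -> 0 < t' < 1 ->
  lerp (f m) (f m.+1) t = lerp (f m') (f m'.+1) t' -> m' = m /\ t' = t.
Proof.
move=> mN m'N t01 t'01 E.
have [mm'|m'm|mm'] := ltngtP m m'.
- by have := step_lt mm' m'N t01 t'01; rewrite E ltxx.
- by have := step_lt m'm mN t'01 t01; rewrite E ltxx.
split=> //; apply/esym; move: E; rewrite -mm' /lerp => /addrI /mulIf; apply.
by rewrite subr_eq0 gt_eqF // f_incr.
Qed.

(** Open intervals between consecutive points are disjoint; downward steps are reduced to upward
    ones by replacing t with 1 - t. *)
Lemma lerp_inj k l k' l' t t' : (k <= N)%N -> (l <= N)%N -> (k' <= N)%N -> (l' <= N)%N ->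
  l = k.+1 \/ k = l.+1 -> l' = k'.+1 \/ k' = l'.+1 ->
  0 < t < 1 -> 0 < t' < 1 -> lerp (f k) (f l) t = lerp (f k') (f l') t' ->
  [/\ k' = k, l' = l & t' = t] \/ [/\ k' = l, l' = k & t' = 1 - t].
Proof.
move=> kN lN k'N l'N kl kl' t01 t'01.
have t1 := onem_itv t01; have t1' := onem_itv t'01.
case: kl => [lE|kE]; case: kl' => [lE'|kE']; subst.
- by move=> /step_inj[] // -> ->; left.
- by rewrite [RHS]lerp_rev => /step_inj[] // -> E; right; split=> //; lra.
- by rewrite [LHS]lerp_rev => /step_inj[] // -> E; right; split=> //; lra.
by rewrite [LHS]lerp_rev [RHS]lerp_rev => /step_inj[] // -> E; left; split=> //; lra.
Qed.

Lemma lerp_avoids k l r t : (k <= N)%N -> (l <= N)%N -> (r <= N)%N ->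
  l = k.+1 \/ k = l.+1 -> 0 < t < 1 -> lerp (f k) (f l) t <> f r.
Proof.
move=> kN lN rN kl t01 E.
wlog lE : k l t kN lN kl t01 E / l = k.+1.
  move=> W; case: (kl) => [|kE]; first exact: (W k l t).
  by apply: (W l k (1 - t)) => //; [left | exact: onem_itv | rewrite -lerp_rev].
have := lerp_bounds (f_incr (ltnSn k) _) t01; rewrite -lE E => /(_ lN) /andP[kr rl].
have [rk|kr'] := leqP r k; first by have := f_le rk kN; rewrite leNgt kr.
by have := @f_le l r; rewrite {1}lE leNgt rl => /(_ kr' rN).
Qed.

Lemma lerp_range k l t : (k <= N)%N -> (l <= N)%N -> l = k.+1 \/ k = l.+1 ->
  0 < t < 1 -> f 0%N <= lerp (f k) (f l) t < f N.
Proof.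
move=> kN lN kl t01.
wlog lE : k l t kN lN kl t01 / l = k.+1.
  move=> W; case: (kl) => [|kE]; first exact: (W k l t).
  by rewrite lerp_rev; apply: (W l k (1 - t)) => //; [left | exact: onem_itv].
have := lerp_bounds (f_incr (ltnSn k) _) t01; rewrite -lE => /(_ lN) /andP[kr rl].
by rewrite (le_trans (f_le (leq0n k) kN) (ltW kr)) (lt_le_trans rl (f_le lN _)).
Qed.

End Increasing.
End Segments.

(** * Coordinates of the grid in the disk *)

Section Drawing.
Variables (R : realType) (n T : nat).

(** The denominators 2 n + 1 here and 2 T + 1 in [ordinate] keep the lower rows in the square [0,
    1/2)^2, inside the disk. The top row lies on the circle, at heights above 1/2 and hence above
    all other rows. *)
Definition abscissa (i : nat) : R := i%:R / n.*2.+1%:R.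

Definition ordinate (i k : nat) : R :=
  if (k < T)%N then k%:R / T.*2.+1%:R else Num.sqrt (1 - abscissa i ^+ 2).

Lemma ratio_incr (m i j : nat) : (i < j)%N -> i%:R / m.*2.+1%:R < j%:R / m.*2.+1%:R :> R.
Proof. by move=> ij; rewrite ltr_pM2r ?ltr_nat // invr_gt0 ltr0n. Qed.

Lemma ratio_bounds (m i : nat) : (i < m)%N ->
  0 <= i%:R / m.*2.+1%:R :> R /\ i%:R / m.*2.+1%:R < 1 / 2 :> R.
Proof.
move=> im; split; first by rewrite divr_ge0 ?ler0n.
by rewrite ltr_pdivrMr ?ltr0n // mul1r mulrC ltr_pdivlMr ?ltr0n // -natrM ltr_nat; lia.
Qed.

Lemma ordinate_top i k : (i < n)%N -> (T <= k)%N ->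
  abscissa i ^+ 2 + ordinate i k ^+ 2 = 1 /\ 1 / 2 < ordinate i k.
Proof.
move=> i_n Tk; rewrite /ordinate ltnNge Tk /=.
have [x0 x1] := ratio_bounds i_n; rewrite -/(abscissa i) in x0 x1 *.
have x2 : abscissa i ^+ 2 < 1 / 4.
  by rewrite expr2; have := ltr_pM x0 x0 x1 x1; lra.
have sq : Num.sqrt (1 - abscissa i ^+ 2) ^+ 2 = 1 - abscissa i ^+ 2.
  by rewrite sqr_sqrtr //; lra.
split; first by rewrite sq; ring.
rewrite ltNge; apply/negP => h.
have := ler_pM (sqrtr_ge0 _) (sqrtr_ge0 _) h h; rewrite -expr2 sq; lra.
Qed.

Lemma ordinate_incr i k l : (i < n)%N -> (k < l)%N -> (l <= T)%N ->
  ordinate i k < ordinate i l.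
Proof.
move=> i_n kl lT; have kT := leq_trans kl lT.
have [lT'|Tl] := ltnP l T.
  by rewrite /ordinate lT' kT; apply: ratio_incr.
have [_] := ordinate_top i_n Tl; apply: lt_trans.
by rewrite /ordinate kT; have [] := ratio_bounds kT.
Qed.

Lemma ordinate_ge0 i k : 0 <= ordinate i k.
Proof. by rewrite /ordinate; case: ifP => _; rewrite ?sqrtr_ge0 // divr_ge0 ?ler0n. Qed.

End Drawing.

(** * The straight-line embedding of the grid *)

Section GridPlanar.
Variables (R : realType) (F : fieldType) (n : nat) (s : seq (layer F n)).
Local Notation T := (size s).
Local Notation G := (grid_network s).

Definition grid_pos (p : vert G) : R * R :=
  (abscissa R n p.1, ordinate R n T p.1 p.2).

Definition grid_arc (e : edge G) (t : R) : R * R :=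
  (lerp (grid_pos (tl e)).1 (grid_pos (hd e)).1 t,
   lerp (grid_pos (tl e)).2 (grid_pos (hd e)).2 t).

Let X := abscissa R n.
Let Y := ordinate R n T.

Let X_incr k l : (k < l)%N -> (l <= n)%N -> X k < X l.
Proof. by move=> kl _; apply: ratio_incr. Qed.

Let Y_incr (i : 'I_n) k l : (k < l)%N -> (l <= T)%N -> Y i k < Y i l.
Proof. exact: ordinate_incr. Qed.

Let X_inj : injective (fun i : 'I_n => X i).
Proof.
move=> i j E; apply: val_inj => /=; have [lt_ij|lt_ji|//] := ltngtP i j.
  by have := X_incr lt_ij (ltnW (ltn_ord j)); rewrite E ltxx.
by have := X_incr lt_ji (ltnW (ltn_ord i)); rewrite E ltxx.
Qed.

Let Y_inj (i : 'I_n) : injective (fun k : 'I_T.+1 => Y i k).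
Proof.
have lt_Y (k l : 'I_T.+1) : (k < l)%N -> Y i k < Y i l.
  by move=> kl; apply: Y_incr => //; rewrite -ltnS.
move=> k l E; apply: val_inj => /=; have [lt_kl|lt_lk|//] := ltngtP k l.
  by have := lt_Y _ _ lt_kl; rewrite E ltxx.
by have := lt_Y _ _ lt_lk; rewrite E ltxx.
Qed.

Let row_Y (i j k : nat) : (k < T)%N -> Y i k = Y j k.
Proof. by rewrite /Y /ordinate => ->. Qed.

Lemma grid_pos_inj : injective grid_pos.
Proof. by move=> [i k] [j l] [/X_inj-> /Y_inj->]. Qed.

Variant arc_spec (e : edge G) : Prop :=
| VerticalArc (i : 'I_n) (k l : 'I_T.+1) of tl e = (i, k) & hd e = (i, l) &
    l = k.+1 :> nat \/ k = l.+1 :> nat &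
    (forall t, grid_arc e t = (X i, lerp (Y i k) (Y i l) t))
| HorizontalArc (i j : 'I_n) (k : 'I_T.+1) of tl e = (i, k) & hd e = (j, k) &
    j = i.+1 :> nat \/ i = j.+1 :> nat & (k < T)%N &
    (forall t, grid_arc e t = (lerp (X i) (X j) t, Y i k)).

Lemma grid_arcP e : arc_spec e.
Proof.
have := grid_edgeP e; rewrite /grid_arc.
case tE : (tl e) => [i k]; case hE : (hd e) => [j l] /= [[ij kl]|[kl kT ij]].
  subst j; apply: VerticalArc (tE) (hE) kl _ => t.
  by rewrite /grid_arc tE hE /= lerp_id.
subst l; apply: HorizontalArc (tE) (hE) ij (kT) _ => t.
by rewrite /grid_arc tE hE /= -!/(Y _ _) (row_Y j i kT) lerp_id.
Qed.

Let le_ord (i : 'I_n) : (i <= n)%N. Proof. exact: ltnW. Qed.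
Let le_row (k : 'I_T.+1) : (k <= T)%N. Proof. by rewrite -ltnS. Qed.

(** Two vertical arcs that meet share an abscissa, hence a wire; two horizontal ones share a height,
    hence a row. The interior of a horizontal arc never has the abscissa of a wire, so it meets no
    vertical arc. *)
Lemma grid_arc_inj e e' t t' : 0 < t < 1 -> 0 < t' < 1 ->
  grid_arc e t = grid_arc e' t' ->
  (e' = e /\ t' = t) \/ (e' = erev e /\ t' = 1 - t).
Proof.
move=> t01 t'01.
have mk : [/\ tl e' = tl e, hd e' = hd e & t' = t] \/
    [/\ tl e' = hd e, hd e' = tl e & t' = 1 - t] ->
    (e' = e /\ t' = t) \/ (e' = erev e /\ t' = 1 - t).
  case=> -[E1 E2 ->]; [left | right]; split=> //; apply: grid_edge_inj => //.
case: (grid_arcP e) => [i k l tE hE kl eE|i j k tE hE ij kT eE];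
case: (grid_arcP e') => [i' k' l' tE' hE' kl' eE'|i' j' k' tE' hE' ij' kT' eE'];
rewrite eE eE' => -[E1 E2]; apply: mk; rewrite tE hE tE' hE'.
- have ii' : i' = i by apply: X_inj.
  move: E2; rewrite ii' => E2.
  by case: (lerp_inj (@Y_incr i) (le_row _) (le_row _)
    (le_row _) (le_row _) kl kl' t01 t'01 E2) => -[/val_inj-> /val_inj-> ->];
    [left|right].
- by case: (lerp_avoids X_incr (le_ord _) (le_ord _) (le_ord i) ij' t'01 (esym E1)).
- by case: (lerp_avoids X_incr (le_ord _) (le_ord _) (le_ord i') ij t01 E1).
have kk' : k' = k.
  by apply: (@Y_inj i) => /=; rewrite E2 (row_Y i i').
by case: (lerp_inj X_incr (le_ord _) (le_ord _)
    (le_ord _) (le_ord _) ij ij' t01 t'01 E1) => -[/val_inj-> /val_inj-> ->];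
  [left|right]; rewrite kk'.
Qed.

Lemma sqnorm_grid_pos p : sqnorm (grid_pos p) = 1 /\ (T <= p.2)%N \/
  sqnorm (grid_pos p) < 1 /\ (p.2 < T)%N.
Proof.
case: p => i k; rewrite /sqnorm /=; have [Tk|kT] := leqP T k.
  by left; have [] := @ordinate_top R n T i k (ltn_ord i) Tk.
right; split=> //; rewrite /ordinate kT.
have [x0 x1] := @ratio_bounds R n i (ltn_ord i).
have [y0 y1] := @ratio_bounds R T k kT.
rewrite -/(abscissa R n i) in x0 x1 *; rewrite !expr2.
move: (abscissa R n i) (k%:R / _) x0 x1 y0 y1 => x y x0 x1 y0 y1.
have := ltr_pM x0 x0 x1 x1; have := ltr_pM y0 y0 y1 y1; lra.
Qed.

(** A vertical arc stays strictly below the point of the circle at the top of its wire; a horizontal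
    one stays in the square [0, 1/2)^2. *)
Lemma grid_arc_open_disk e t : 0 < t < 1 -> sqnorm (grid_arc e t) < 1.
Proof.
move=> t01; case: (grid_arcP e) => [i k l _ _ kl|i j k _ _ ij kT] ->; rewrite /sqnorm /=.
  have [<- _] := @ordinate_top R n T i T (ltn_ord i) (leqnn _).
  have /andP[y0 y1] := lerp_range (@Y_incr i)
    (le_row k) (le_row l) kl t01.
  have y00 := le_trans (ordinate_ge0 _ _ _ _ _) y0.
  by rewrite ltrD2l !expr2 ltr_pM.
have [x0 x1] : 0 <= lerp (X i) (X j) t /\ lerp (X i) (X j) t < 1 / 2.
  have Xb (m : 'I_n) : 0 <= X m < 1 / 2.
    by have [? ?] := @ratio_bounds R n m (ltn_ord m); apply/andP.
  have := Xb i; have := Xb j; move: t01 => /andP[t0 t1] /andP[j0 j1] /andP[i0 i1].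
  rewrite (_ : lerp _ _ _ = (1 - t) * X i + t * X j); last by rewrite /lerp; ring.
  have t1' : 0 < 1 - t by rewrite subr_gt0.
  have a1 : (1 - t) * X i < (1 - t) * (1 / 2) by rewrite ltr_pM2l.
  have a2 : t * X j < t * (1 / 2) by rewrite ltr_pM2l.
  by split; [rewrite addr_ge0 // mulr_ge0 // ltW | lra].
have [y0 y1] : 0 <= Y i k /\ Y i k < 1 / 2.
  by rewrite /Y /ordinate kT; apply: ratio_bounds.
move: (lerp _ _ _) (Y i k) x0 x1 y0 y1 => x y x0 x1 y0 y1; rewrite !expr2.
have := ltr_pM x0 x0 x1 x1; have := ltr_pM y0 y0 y1 y1; lra.
Qed.

Lemma grid_embedding : disk_embedding grid_pos grid_arc.
Proof.
split.
- by move=> e; split; apply: smooth_lerp.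
- move=> e t _; rewrite !derive1_lerp /lerp !subrr !mulr0 !addr0 => -[E1 E2].
  have : grid_pos (hd e) = grid_pos (tl e).
    rewrite [LHS]surjective_pairing [RHS]surjective_pairing.
    by congr (_, _); apply/eqP; rewrite -subr_eq0 ?E1 ?E2.
  move=> /grid_pos_inj.
  case: (grid_arcP e) => [i k l -> -> kl _|i j k -> -> ij _ _] [E].
    by move: kl; rewrite E; lia.
  by move: ij; rewrite E; lia.
- by move=> e t _; rewrite /grid_arc /tl erevK; congr (_, _); apply: lerp_rev.
- by move=> e; rewrite [RHS]surjective_pairing /grid_arc /lerp !mul0r !addr0.
- move=> e; rewrite [RHS]surjective_pairing /grid_arc /lerp !mul1r.
  by congr (_, _); rewrite addrC subrK.
- by move=> p; case: (sqnorm_grid_pos p) => -[]; [move=> -> | move/ltW].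
- move=> p; rewrite (_ : (p \in bdry G) = (T <= p.2)%N).
    case: (sqnorm_grid_pos p) => -[p1 pT]; first by rewrite p1.
    rewrite leqNgt pT; split=> // p1'; by rewrite p1' ltxx in p1.
  case: p => i k; apply/imsetP/idP => [[j _ [_ ->]] //|Tk].
  exists i => //; congr (_, _); apply: val_inj; apply/eqP.
  by rewrite eqn_leq Tk -ltnS ltn_ord.
- exact: grid_arc_open_disk.
- exact: grid_pos_inj.
- move=> e t [i' k'] t01; case: (grid_arcP e) => [i k l _ _ kl|i j k _ _ ij kT] -> [E1].
    by rewrite -(X_inj E1); apply: (lerp_avoids (@Y_incr i)).
  by case: (lerp_avoids X_incr (le_ord _) (le_ord _) (le_ord i') ij t01 E1).
- exact: grid_arc_inj.
Qed.

Lemma grid_circular_planar : circular_planar R G.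
Proof. by exists grid_pos, grid_arc; apply: grid_embedding. Qed.

End GridPlanar.

(** * Fields other than F_2, and the conclusion *)

Lemma neq_F2_third_element (F : fieldType) :
  ~ (exists f : {rmorphism 'F_2 -> F}, bijective f) ->
  exists2 t : F, t != 0 & t != 1.
Proof.
move=> not_F2; apply: contrapT => no_t.
(* If 0 and 1 exhaust F, then 1 + 1 = 0, and matching 0 with 0 and 1 with 1 is an isomorphism from
   F_2. *)
have F01 (t : F) : t = 0 \/ t = 1.
  have [|t0] := eqVneq t 0; first by left.
  by have [|t1] := eqVneq t 1; [right | case: no_t; exists t].
have F11 : 1 + 1 = 0 :> F.
  case: (F01 (1 + 1)) => // /(canRL (addrK _)); rewrite subrr => /eqP.
  by rewrite oner_eq0.
pose f (x : 'F_2) : F := if x == 0 then 0 else 1.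
have F2_01 (x : 'F_2) : x = 0 \/ x = 1.
  by case: x => [[|[|//]]] ?; [left | right]; apply: val_inj.
have fB : zmod_morphism f.
  move=> x y; case: (F2_01 x) => ->; case: (F2_01 y) => ->;
    rewrite /f /= ?subr0 ?subrr // sub0r.
  by apply/eqP; rewrite -addr_eq0 F11.
have fM : monoid_morphism f.
  split=> // x y; case: (F2_01 x) => ->; case: (F2_01 y) => ->;
    by rewrite /f /= ?mul0r ?mulr0 ?mulr1.
pose fz := GRing.isZmodMorphism.Build _ _ f fB.
pose fm := GRing.isMonoidMorphism.Build _ _ f fM.
pose g : {rmorphism 'F_2 -> F} := HB.pack f fz fm.
apply: not_F2; exists g; exists (fun t => if t == 0 then 0 else 1).
  by move=> x; rewrite /g /= /f; case: (F2_01 x) => -> /=; rewrite ?eqxx ?oner_eq0.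
by move=> t; rewrite /g /= /f; case: (F01 t) => ->; rewrite ?eqxx ?oner_eq0.
Qed.

Theorem mainTheorem13 (R : realType) (F : fieldType)
  (F_neq_F2 : ~ exists f : {rmorphism 'F_2 -> F}, bijective f)
  (n : nat) (L : {vspace ('rV[F]_n * 'rV[F]_n)%type}) :
  EG L ->
  exists N : network F n,
    [/\ layerable N, circular_planar R N & boundary_behavior N L].
Proof.
move=> /EG_normal_form[d [C [C_sym LP]]].
have F_big := neq_F2_third_element F_neq_F2.
(* The word s realizes the normal form of L, and the grid of s applies it to the states (x, 0). *)
have [s s_ok sE] := layered_comp (layered_edges F_big C_sym) (layered_spikes F_big d).
exists (grid_network s); split.
- exact: grid_layerable.
- exact: grid_circular_planar.
move=> z; rewrite (grid_behavior z s_ok) LP.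
by split=> -[x ->]; exists x; rewrite -sE.
Qed.
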